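(* Let $X$ be an $h$-homogeneous, first-countable, compact Hausdorff space with more than one point, such that the set $\{x\in X : \{x\}\text{ is a connected component of }X\}$ of $1$-point components is dense in $X$. Then $X$ is non-reconstructible.
   Context: A space $X$ is $h$-homogeneous if every non-empty clopen subset of $X$ is homeomorphic to $X$. For a topological space $X$, $[Y]$ denotes the homeomorphism class of $Y$, and the deck of $X$ is the set $\mathcal{D}(X)=\{[X\setminus\{x\}] : x\in X\}$. The space $X$ is reconstructible if every topological space $Z$ with $\mathcal{D}(Z)=\mathcal{D}(X)$ is homeomorphic to $X$; it is non-reconstructible otherwise. *)

(* Defs.v *)
From HB Require Import structures.
From mathcomp Require Import all_boot all_classical topology.

Set Implicit Arguments.
Unset Strict Implicit.
Unset Printing Implicit Defensive.

Local Open Scope classical_set_scope.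

Definition homeomorphic (X Y : topologicalType) : Prop :=
  exists (f : X -> Y) (g : Y -> X),
    [/\ continuous f, continuous g, cancel f g & cancel g f].

(* A set [A : set X] used as a space is the sigma-type [set_type A], whose
   canonical topology is the one induced by [X]; it may be empty. *)
Definition h_homogeneous (X : topologicalType) : Prop :=
  forall A : set X, A !=set0 -> clopen A -> homeomorphic (set_type A) X.

Definition first_countable (X : topologicalType) : Prop :=
  forall x : X, exists B : set_system X,
    [/\ countable B, B `<=` nbhs x &
        forall U, nbhs x U -> exists2 V, B V & V `<=` U].

Definition one_point_components (X : topologicalType) : set X :=
  [set x | connected_component [set: X] x = [set x]].
Arguments one_point_components : clear implicits.

(* [topologicalType] is too large for [set], so classes of spaces, and
   collections of such classes, are written as plain predicates. *)
Definition homeomorphism_class (Y : topologicalType) : topologicalType -> Prop :=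
  fun Y' => homeomorphic Y Y'.

Definition deck (X : topologicalType) : (topologicalType -> Prop) -> Prop :=
  fun C => exists x : X, C = homeomorphism_class (set_type (~` [set x])).

Definition reconstructible (X : topologicalType) : Prop :=
  forall Z : topologicalType, deck Z = deck X -> homeomorphic Z X.

(* Main.v *)
Require Import Defs.
From HB Require Import structures.
From mathcomp Require Import all_boot all_classical topology.

Set Implicit Arguments.
Unset Strict Implicit.
Unset Printing Implicit Defensive.

Local Open Scope classical_set_scope.

(** The space [Z = X \ {x}], for [x] a one-point component, has the same deck as
    [X] without being compact, so it witnesses non-reconstructibility.

    The two decks agree because [X \ {x, z}] and [X \ {y}] are homeomorphic
    whenever [z <> x] and a homeomorphism from a certain clopen neighbourhood
    of [z] onto [X] takes [z] to [y] ([doubly_punctured]).  Two decompositions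
    are behind this.

    On the one hand, in a compact Hausdorff space a component is an
    intersection of clopen sets, so [x] has arbitrarily small clopen
    neighbourhoods; by first countability [X \ {x}] is a countable disjoint
    union of clopen sets [P_n] of [X] ([shrinking_label]).  On the other hand,
    around every point [y] the one-point components are dense and [y] is not
    isolated, so there is a sequence of disjoint non-empty clopen sets [V_n]
    converging to [y]; hence [X \ {y}] is the topological sum of the [V_n] and
    of a remainder [W] ([accumulating_label]).

    Let [P] be the piece [P_k] that contains [z] and let [f : P -> X] be a
    homeomorphism, which exists by h-homogeneity, with [f z = y].  Then
    [X \ {x, z}] is the topological sum of the preimage of [W] under [f] and of
    the preimages of the [V_n], together with the [P_n] for [n <> k].  The
    extra pieces are absorbed: adjoin [P_n] to the preimage of [V_n].  The
    result is again a non-empty clopen subset of [X], and all of those are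
    homeomorphic to each other, in particular to [V_n].  Matching these pieces
    with the [V_n], and the preimage of [W] with [W], gives the homeomorphism
    ([homeo_sets_glue]).  Since [V_n] is non-empty, it does not matter whether
    some of the [P_n] are empty. *)

(** * Homeomorphisms between subsets of one space *)

Section set_homeomorphisms.
Context {X : topologicalType}.
Implicit Types (A B C S : set X) (f g : X -> X).

(** One half of a homeomorphism between the subspaces [A] and [B]: [f] maps [A]
    continuously into [B], with left inverse [g].  The maps are total on [X]
    and only constrained on [A], so that they can be restricted and glued
    without transport between subtypes; the continuity clause is that of the
    subspace topology.  Splitting a homeomorphism in two symmetric halves lets
    each closure property be proved for one half only. *)
Definition embeds A B f g := forall a, A a ->
  [/\ B (f a), g (f a) = a &
      forall U, nbhs (f a) U -> \forall b \near a, A b -> U (f b)].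

Definition homeo_sets A B := exists f g, embeds A B f g /\ embeds B A g f.

Lemma homeo_sets_sym A B : homeo_sets A B -> homeo_sets B A.
Proof. by move=> [f [g [fg gf]]]; exists g, f. Qed.

Lemma embeds_comp A B C f g f' g' :
  embeds A B f g -> embeds B C f' g' -> embeds A C (f' \o f) (g \o g').
Proof.
move=> AB BC a Aa; have [Bfa gfa cf] := AB a Aa.
have [Cfa gfa' cf'] := BC _ Bfa; split=> //=; first by rewrite gfa'.
move=> U /cf'/cf; apply: filterS => b /= + Ab.
by apply=> //; have [] := AB b Ab.
Qed.

Lemma homeo_sets_trans B A C :
  homeo_sets A B -> homeo_sets B C -> homeo_sets A C.
Proof.
move=> [f [g [fg gf]]] [f' [g' [fg' gf']]].
by exists (f' \o f), (g \o g'); split; apply: embeds_comp; eassumption.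
Qed.

Lemma embeds_restrict A A' B B' f g :
  embeds A B f g -> A' `<=` A -> (forall a, A' a -> B' (f a)) ->
  embeds A' B' f g.
Proof.
move=> AB sA fB a A'a; have [_ gfa cf] := AB _ (sA _ A'a).
split=> //; first exact: fB.
by move=> U /cf; apply: filterS => b /= + /sA.
Qed.

Lemma homeo_sets_preimage A B S f g :
  embeds A B f g -> embeds B A g f ->
  homeo_sets (A `&` f @^-1` S) (B `&` S).
Proof.
move=> fg gf; exists f, g; split.
- by apply: (embeds_restrict fg) => [a []|a [/fg[]]].
- apply: (embeds_restrict gf) => [a []//|a [/gf[Aga fga _] Sa]].
  by split; rewrite //= fga.
Qed.

Lemma embeds_preimage_open A B S f g :
  embeds A B f g -> open A -> open S -> open (A `&` f @^-1` S).
Proof.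
move=> fg oA oS; rewrite openE /interior => a [Aa Sfa]; have [_ _ cf] := fg a Aa.
have /cf nS : nbhs (f a) S by exact: open_nbhs_nbhs.
have nA : nbhs a A by exact: open_nbhs_nbhs.
by apply: filterS2 nS nA => b SA Ab; split=> //; apply: SA.
Qed.

(** The complement of the preimage is the complement of [A] together with the
    preimage of the complement of [S], so openness of preimages suffices. *)
Lemma embeds_preimage_clopen A B S f g :
  embeds A B f g -> clopen A -> clopen S -> clopen (A `&` f @^-1` S).
Proof.
move=> fg [oA cA] [oS cS]; split; first exact: embeds_preimage_open fg oA oS.
rewrite -openC.
have -> : ~` (A `&` f @^-1` S) = ~` A `|` (A `&` f @^-1` (~` S)).
  apply/seteqP; split=> a /=.
  - by move=> /not_andP; case: (pselect (A a)) => Aa; [case|left]; tauto.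
  - by tauto.
by apply: openU; [rewrite openC|apply: (embeds_preimage_open fg oA); rewrite openC].
Qed.

Definition locally_constant_on (I : Type) A (p : X -> I) :=
  forall a, A a -> \forall b \near a, A b -> p b = p a.

(** Near [a] the glued map agrees with the single map [f (p a)], so it inherits
    its continuity. *)
Lemma embeds_glue (I : Type) A B (p q : X -> I) (f g : I -> X -> X) :
  (forall i, embeds (A `&` p @^-1` [set i]) (B `&` q @^-1` [set i]) (f i) (g i)) ->
  locally_constant_on A p ->
  embeds A B (fun a => f (p a) a) (fun b => g (q b) b).
Proof.
move=> fg pA a Aa; have [[Bfa /= qfa] gfa cf] := fg (p a) a (conj Aa erefl).
split=> //; first by rewrite qfa.
move=> U /cf nU; apply: filterS2 nU (pA a Aa) => b /= nU pb Ab.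
by rewrite pb //; apply: nU; split=> //; apply: pb.
Qed.

(** A locally constant labelling presents a subspace as the topological sum of
    its fibres, so matching the fibres label by label suffices. *)
Lemma homeo_sets_glue (I : Type) A B (p q : X -> I) :
  locally_constant_on A p -> locally_constant_on B q ->
  (forall i, homeo_sets (A `&` p @^-1` [set i]) (B `&` q @^-1` [set i])) ->
  homeo_sets A B.
Proof.
move=> pA qB /choice [f /choice [g fg]].
exists (fun a => f (p a) a), (fun b => g (q b) b).
by split; apply: embeds_glue => // i; have [] := fg i.
Qed.

End set_homeomorphisms.

(** * Passage to and from subtypes *)

Section homeomorphic.

Lemma homeomorphic_sym (X Y : topologicalType) :
  homeomorphic X Y -> homeomorphic Y X.
Proof. by move=> [f [g [cf cg fg gf]]]; exists g, f. Qed.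

Lemma homeomorphic_trans (Y X Z : topologicalType) :
  homeomorphic X Y -> homeomorphic Y Z -> homeomorphic X Z.
Proof.
move=> [f [g [cf cg fg gf]]] [f' [g' [cf' cg' fg' gf']]].
exists (f' \o f), (g \o g'); split; try exact: can_comp.
- by move=> x; apply: continuous_comp; [exact: cf|exact: cf'].
- by move=> x; apply: continuous_comp; [exact: cg'|exact: cg].
Qed.

Lemma homeomorphism_class_eq (X Y : topologicalType) :
  homeomorphic X Y -> homeomorphism_class X = homeomorphism_class Y.
Proof.
move=> XY; apply/funext => Z; apply/propext; split.
- exact: homeomorphic_trans (homeomorphic_sym XY).
- exact: homeomorphic_trans XY.
Qed.

Lemma nbhs_set_typeP (X : topologicalType) (A : set X) (s : set_type A)
    (U : set (set_type A)) :
  nbhs s U <-> exists2 V, nbhs (set_val s) V & set_val @^-1` V `<=` U.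
Proof.
split=> [|[V nV VU]].
- rewrite {1}nbhsE => -[_ [[V oV <-] Vs] VU].
  by exists V => //; exists V.
- apply: filterS VU _; exact: (@initial_continuous _ _ set_val s V nV).
Qed.

Lemma set_val_inj (T : Type) (A : set T) : injective (@set_val T A).
Proof. exact: val_inj. Qed.

Lemma embeds_continuous (X : topologicalType) (A B : set X) (f g : X -> X)
    (F : set_type A -> set_type B) :
  embeds A B f g -> (forall s, set_val (F s) = f (set_val s)) -> continuous F.
Proof.
move=> fg Ff s U /nbhs_set_typeP [V]; rewrite Ff => nV VU.
have [_ _ cf] := fg _ (set_valP s); apply/nbhs_set_typeP.
exists (fun b => A b -> V (f b)) => [|t tV /=]; first exact: cf.
by apply: VU => /=; rewrite Ff; apply: tV; exact: set_valP.
Qed.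

Lemma homeo_sets_homeomorphic (X : topologicalType) (A B : set X) :
  homeo_sets A B -> homeomorphic (set_type A) (set_type B).
Proof.
move=> [f [g [fg gf]]].
have fP (s : set_type A) : f (set_val s) \in B.
  by apply/mem_set; have [] := fg _ (set_valP s).
have gP (s : set_type B) : g (set_val s) \in A.
  by apply/mem_set; have [] := gf _ (set_valP s).
exists (fun s => SigSub (fP s)), (fun s => SigSub (gP s)); split.
- exact: embeds_continuous fg _.
- exact: embeds_continuous gf _.
- by move=> s; apply: set_val_inj; have [] := fg _ (set_valP s).
- by move=> s; apply: set_val_inj; have [] := gf _ (set_valP s).
Qed.

(** A point of [A] is what extends a map defined on the subtype to all of [X]. *)
Lemma homeomorphic_homeo_sets (X : topologicalType) (A : set X) :
  A !=set0 -> homeomorphic (set_type A) X -> homeo_sets A [set: X].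
Proof.
move=> [a0 Aa0] [f [g [cf cg fg gf]]].
pose s0 : set_type A := SigSub (mem_set Aa0).
pose f' x := f (insubd s0 x).
have f'E (s : set_type A) : f' (set_val s) = f s by rewrite /f' valKd.
have valE x : A x -> exists s : set_type A, set_val s = x.
  by move=> Ax; exists (SigSub (mem_set Ax)).
exists f', (set_val \o g); split.
- move=> _ /valE[s <-]; split=> //=; first by rewrite f'E fg.
  rewrite f'E => U /cf /nbhs_set_typeP [V nV VU].
  apply: filterS nV => b Vb /valE[t tb].
  by move: Vb; rewrite -tb f'E; exact: VU.
- move=> x _; split=> /=; first exact: set_valP.
    by rewrite f'E gf.
  move=> U /(@initial_continuous _ _ set_val (g x) U) nU.
  have gU : nbhs x (g @^-1` (set_val @^-1` U)) by exact: cg.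
  by apply: filterS gU => b Ub _; exact: Ub.
Qed.

Lemma homeomorphic_punctured (X : topologicalType) (x : X)
    (z : set_type (~` [set x])) :
  homeomorphic (set_type (~` [set z])) (set_type (~` [set x; set_val z])).
Proof.
pose D := ~` [set x; set_val z]; pose Z : set X := ~` [set x].
have fP (s : set_type (~` [set z])) : set_val (set_val s) \in D.
  apply/mem_set => -[sx|/set_val_inj sz].
  - exact: (set_valP (set_val s) sx).
  - exact: (set_valP s sz).
have gP (d : set_type D) : set_val d \in Z.
  by apply/mem_set => dx; apply: (set_valP d); left.
have gP' (d : set_type D) : SigSub (gP d) \in ~` [set z].
  apply/mem_set => dz; apply: (set_valP d); right.
  by have /(congr1 set_val) := dz.
exists (fun s => SigSub (fP s)), (fun d => SigSub (gP' d)); split.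
- move=> s U /nbhs_set_typeP[V nV VU]; apply/nbhs_set_typeP.
  exists (set_val @^-1` V); last by move=> t /= ?; apply: VU.
  by apply/nbhs_set_typeP; exists V.
- move=> d U /nbhs_set_typeP[V /nbhs_set_typeP[W nW WV] VU].
  apply/nbhs_set_typeP; exists W => //.
  by move=> t /= ?; apply: VU; apply: WV.
- by move=> s; do 2 apply: set_val_inj.
- by move=> d; apply: set_val_inj.
Qed.

End homeomorphic.

(** * Labelling points by the first member of a sequence of sets *)

Section first_index.
Context {X : topologicalType} (S : nat -> set X).

Definition first_index (u : X) : option nat :=
  if pselect (exists n, `[< S n u >]) is left e then Some (ex_minn e) else None.

Lemma first_indexN u : first_index u = None <-> forall n, ~ S n u.
Proof.
rewrite /first_index; case: pselect => [e|ne]; split=> //.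
- by move=> nS; exfalso; case: e => n /asboolP /nS.
- by move=> _ n Sn; apply: ne; exists n; apply/asboolP.
Qed.

Lemma first_indexS u n :
  first_index u = Some n <-> S n u /\ (forall m, (m < n)%N -> ~ S m u).
Proof.
rewrite /first_index; case: pselect => [e|ne]; last first.
  by split=> // -[Sn _]; case: ne; exists n; apply/asboolP.
case: ex_minnP => k /asboolP Sk kmin; split=> [[<-]|[Sn nmin]].
- split=> // m mk /asboolP /kmin; by rewrite leqNgt mk.
- congr Some; apply/eqP; rewrite eqn_leq kmin /=; last exact/asboolP.
  by rewrite leqNgt; apply/negP => /nmin.
Qed.

(** The fibre over [Some n] is [S n] minus the finitely many earlier sets. *)
Lemma first_index_clopen n :
  (forall m, clopen (S m)) -> clopen (first_index @^-1` [set Some n]).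
Proof.
move=> cS.
have -> : first_index @^-1` [set Some n] =
    S n `&` ~` (\big[setU/set0]_(m < n) S m).
  apply/seteqP; split=> u /=.
  - move=> /first_indexS [Sn nmin]; split=> //.
    by rewrite -bigcup_mkord => -[m /= /nmin].
  - move=> [Sn]; rewrite -bigcup_mkord => nS; apply/first_indexS; split=> //.
    by move=> m mn Sm; apply: nS; exists m.
apply: clopenI => //; apply: (@clopenC _ _ set0).
by apply: (@big_ind _ (@clopen X) _ _ clopen0 (@clopenU X)) => i _; exact: cS.
Qed.

End first_index.

(** * Clopen neighbourhoods of one-point components *)

Section compact_hausdorff.
Context {X : topologicalType}.
Hypotheses (cX : compact [set: X]) (T2X : hausdorff_space X).

(** Otherwise the traces on the complement of [O] of the clopen sets containing
    [x] generate a proper filter; by compactness it clusters at a point outside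
    [O], which lies in all these clopen sets as they are closed. *)
Lemma clopen_sub_open_nbhs (x : X) (O : set X) : open O ->
  \bigcap_(F in [set F | F x /\ clopen F]) F `<=` O ->
  exists F, [/\ clopen F, F x & F `<=` O].
Proof.
move=> oO QO; apply: contrapT => noF.
pose G := filter_from [set F | F x /\ clopen F] (fun F => F `&` ~` O).
have PG : ProperFilter G.
  apply: filter_from_proper => [|F [Fx cF]]; last first.
    apply: contrapT => /set0P/negP/negPn/eqP FO; apply: noF; exists F; split=> //.
    by move=> u Fu; apply: contrapT => nOu; have : set0 u by rewrite -FO.
  apply: filter_from_filter.
    by exists setT; split=> //; exact: clopenT.
  move=> F F' [Fx cF] [Fx' cF']; exists (F `&` F').
    by split=> //; exact: clopenI.
  by move=> u [[? ?] ?].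
have [w [_ wG]] := cX PG filterT.
have /closure_id clO : closed (~` O) by rewrite closedC.
have : (~` O) w.
  rewrite clO => U nU; apply: wG => //.
  by exists setT => [|u []//]; split=> //; exact: clopenT.
apply; apply: QO => F [Fx [oF cF]].
have /closure_id -> := cF.
by move=> U nU; apply: wG => //; exists F => // u [].
Qed.

(** If the quasicomponent [Q] of [x] splits into closed parts [A] and [B] with
    [x] in [A], normality gives an open [U] around [A] whose closure misses [B].
    A clopen [F] containing [x] lies in [U] or the exterior of [U], by
    [clopen_sub_open_nbhs]; then [F] intersected with [U] is a clopen
    set containing [x], so it contains [Q], and [B] is empty. *)
Lemma quasicomponent_connected (x : X) :
  connected (\bigcap_(F in [set F | F x /\ clopen F]) F).
Proof.
set Q := \bigcap_(F in _) F.
have Qx : Q x by move=> F [].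
have cQ : closed Q by apply: closed_bigI => F [_ []].
have key (A B : set X) : closed A -> closed B -> A `|` B = Q ->
    A `&` B = set0 -> A x -> Q `<=` A.
  move=> cA cB ABQ AB0 Ax.
  have /(compact_normal T2X cX cA) [V] : set_nbhs A (~` B).
    apply/set_nbhsP; exists (~` B); split=> //; first by rewrite openC.
    by move=> u Au Bu; have : set0 u by rewrite -AB0.
  move=> /set_nbhsP[U [oU AU UV]] VB.
  have oW : open (U `|` ~` closure V).
    by apply: openU => //; rewrite openC; exact: closed_closure.
  have [u|F [[oF cF] Fx FW]] := @clopen_sub_open_nbhs x _ oW.
    rewrite -/Q -ABQ => -[/AU|Bu]; first by left.
    by right=> /VB.
  have cFU : clopen (F `&` U).
    split; first exact: openI.
    have -> : F `&` U = F `&` closure V.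
      apply/seteqP; split=> u [Fu].
      - by move=> /UV ?; split=> //; exact: subset_closure.
      - by move=> Vu; split=> //; have [] := FW u Fu.
    by apply: closedI => //; exact: closed_closure.
  move=> u Qu; have [|_ Uu] := Qu (F `&` U); first by split=> //; split=> //; exact: AU.
  move: Qu; rewrite -ABQ => -[//|Bu].
  by exfalso; apply: (VB u) => //; apply: subset_closure; exact: UV.
move=> B [b Bb] [C oC BC] [D cD BD].
have cB : closed B by rewrite BD; exact: closedI.
have cQB : closed (Q `&` ~` C) by apply: closedI => //; rewrite closedC.
have BQ : B `<=` Q by rewrite BC => u [].
have BU : B `|` (Q `&` ~` C) = Q.
  apply/seteqP; split=> [u [/BQ//|[]//]|u Qu].
  by case: (pselect (C u)) => Cu; [left; rewrite BC|right].
have BI : B `&` (Q `&` ~` C) = set0.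
  by rewrite -subset0 => u []; rewrite {1}BC => -[_ Cu] [_ /(_ Cu)].
apply/seteqP; split=> //; case: (pselect (B x)) => Bx.
  exact: key cB cQB BU BI Bx.
have : Q `<=` Q `&` ~` C.
  apply: key cQB cB _ _ _; [by rewrite setUC|by rewrite setIC|].
  by move: Qx; rewrite -{1}BU => -[].
by move=> /(_ b (BQ b Bb))[_ nCb]; move: Bb; rewrite BC => -[].
Qed.

(** The quasicomponent of [x] is connected, hence inside the component [{x}]. *)
Lemma one_point_component_clopen_nbhs (x : X) (U : set X) :
  one_point_components X x -> nbhs x U ->
  exists F, [/\ clopen F, F x & F `<=` U].
Proof.
move=> x1; rewrite nbhsE => -[O [oO Ox] OU].
have [u Qu|F [cF Fx FO]] := @clopen_sub_open_nbhs x O oO.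
  suff -> : u = x by [].
  have : connected_component [set: X] x u.
    apply: connected_component_max Qu => //; first by move=> F [].
    exact: quasicomponent_connected.
  by rewrite x1.
by exists F; split=> // u /FO/OU.
Qed.

Hypothesis fcX : first_countable X.

Lemma decreasing_nbhs_base (x : X) : exists O : nat -> set X,
  [/\ forall n, nbhs x (O n), forall m n, (m <= n)%N -> O n `<=` O m &
      forall U, nbhs x U -> exists n, O n `<=` U].
Proof.
have [B [cB Bx Bbase]] := fcX x.
(* [O n] is the intersection of the members of [B] that are numbered below
   [n] by the injection [i]. *)
have [i iinj] := countable_injP _ cB.
pose O n : set X := [set u | forall V, B V -> (i V < n)%N -> V u].
exists O; split.
- elim=> [|n IHn]; first by apply: filterS filterT => u _ V.
  have [[V0 [BV0 iV0]]|noV] := pselect (exists V, B V /\ i V = n).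
    apply: filterS2 IHn (Bx _ BV0) => u Ou V0u V BV.
    rewrite ltnS leq_eqVlt => /predU1P[iV|]; last exact: Ou.
    suff -> : V = V0 by [].
    by apply: iinj; rewrite ?inE// iV0.
  apply: filterS IHn => u Ou V BV.
  rewrite ltnS leq_eqVlt => /predU1P[iV|]; last exact: Ou.
  by case: noV; exists V.
- by move=> m n mn u Ou V BV iV; apply: Ou => //; exact: leq_trans mn.
- move=> U /Bbase[V BV VU]; exists (i V).+1 => u Ou; apply: VU; exact: Ou.
Qed.

End compact_hausdorff.

(** * Decompositions of the punctured space *)

Section h_homogeneous_space.
Context {X : topologicalType}.
Hypotheses (hX : h_homogeneous X) (fcX : first_countable X).
Hypotheses (cX : compact [set: X]) (T2X : hausdorff_space X).
Hypotheses (ntX : exists x y : X, x <> y) (dX : dense (one_point_components X)).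

Let closed_point (x : X) : closed [set x].
Proof. exact: accessible_closed_set1 (hausdorff_accessible T2X) _. Qed.

Lemma clopen_homeo_sets (A B : set X) :
  clopen A -> A !=set0 -> clopen B -> B !=set0 -> homeo_sets A B.
Proof.
have full (C : set X) : clopen C -> C !=set0 -> homeo_sets C [set: X].
  by move=> cC C0; apply: homeomorphic_homeo_sets => //; exact: hX.
move=> cA A0 cB B0; apply: homeo_sets_trans (full _ cA A0) _.
exact: homeo_sets_sym (full _ cB B0).
Qed.

(** An isolated point would be a non-empty clopen set, hence homeomorphic to
    [X], which has two points. *)
Lemma no_isolated_point (x : X) : ~ open [set x].
Proof.
move=> ox; have [a [b ab]] := ntX; apply: ab.
have x0 : [set x] !=set0 by exists x.
have T0 : [set: X] !=set0 by exists x.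
have cx : clopen [set x] by [].
have [f [g [fg _]]] := clopen_homeo_sets clopenT T0 cx x0.
have [fa <- _] := fg a I; have [fb <- _] := fg b I.
by rewrite fa fb.
Qed.

(** Otherwise [X \ {x}] would be compact, hence closed, and [x] isolated. *)
Lemma punctured_not_homeomorphic (x : X) :
  ~ homeomorphic (set_type (~` [set x])) X.
Proof.
move=> [f [g [_ cg fg _]]]; apply: (@no_isolated_point x).
rewrite -closedC; apply: compact_closed => //.
have -> : ~` [set x] = (set_val \o g) @` [set: X].
  apply/seteqP; split=> [u xu|_ [v _ <-]]; last exact: set_valP.
  by exists (f (SigSub (mem_set xu))) => //=; rewrite fg.
apply: continuous_compact => //; apply: continuous_subspaceT => u.
apply: continuous_comp; first exact: cg.
exact: initial_continuous.
Qed.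

(** Label a point by the first member it avoids in a sequence of clopen
    neighbourhoods of [x] that shrinks to [x]. *)
Lemma shrinking_label (x : X) : one_point_components X x ->
  exists p : X -> option nat, (forall u, p u = None <-> u = x) /\
    (forall n, clopen (p @^-1` [set Some n])).
Proof.
move=> x1; have [O [nO _ Obase]] := decreasing_nbhs_base fcX x.
have /choice [F FP] : forall n, exists F, [/\ clopen F, F x & F `<=` O n].
  by move=> n; exact: one_point_component_clopen_nbhs.
exists (first_index (fun n => ~` F n)); split=> [u|n]; last first.
  by apply: first_index_clopen => m; apply: (@clopenC _ _ set0); have [] := FP m.
rewrite first_indexN; split=> [uF|-> n]; last by have [_ Fx _] := FP n.
apply: contrapT => ux.
have [|n On] := Obase (~` [set u]).
  apply: open_nbhs_nbhs; split; first by rewrite openC.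
  by move=> xu; apply: ux.
apply: (uF n) => Fu; have [_ _ /(_ _ Fu)/On] := FP n.
by apply.
Qed.

(** One step in building clopen sets that converge to [y]: the increment is a
    clopen neighbourhood of a one-point component other than [y], found in [U]
    outside of [E]. *)
Lemma clopen_increment (y : X) (E U : set X) :
  clopen E -> ~ E y -> nbhs y U ->
  exists E', [/\ clopen E', ~ E' y, E `<=` E', E' `\` E `<=` U & E' `\` E !=set0].
Proof.
move=> cE nEy nU.
have : nbhs y (U `&` ~` E).
  apply: filterI => //; apply: open_nbhs_nbhs; split=> //.
  by rewrite openC; have [] := cE.
rewrite nbhsE => -[G [oG Gy] GU].
have [||t [[Gt ty] t1]] := @dX (G `&` ~` [set y]).
- apply: contrapT => /set0P/negP/negPn/eqP G0; apply: (@no_isolated_point y).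
  suff <- : G = [set y] by [].
  apply/seteqP; split=> [u Gu|_ -> //].
  by apply: contrapT => uy; have : set0 u by rewrite -G0.
- by apply: openI => //; rewrite openC.
have [|C [cC Ct CG]] := one_point_component_clopen_nbhs cX T2X (U := G `&` ~` [set y]) t1.
  by apply: open_nbhs_nbhs; split=> //; apply: openI => //; rewrite openC.
exists (E `|` C); split.
- exact: clopenU.
- by move=> [//|/CG[_]]; exact.
- by move=> u; left.
- by move=> u [[Eu /(_ Eu)//|/CG[/GU[Uu _] _]]].
- by exists t; split; [right|have [] := GU t Gt].
Qed.

(** The fibres over [Some n] are the successive increments of a sequence of
    clopen sets [E n], the [n]-th one inside the [n]-th basic neighbourhood of
    [y].  They can only accumulate at [y]: any other point has a neighbourhood
    [N] missing some basic neighbourhood [O n], hence all increments from the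
    [n]-th on. This makes the labelling locally constant also at the points of
    the remainder, labelled [None]. *)
Lemma accumulating_label (y : X) : exists q : X -> option nat,
  [/\ forall n, clopen (q @^-1` [set Some n]),
      forall n, q @^-1` [set Some n] !=set0,
      q y = None & locally_constant_on (~` [set y]) q].
Proof.
have [O [nO Odec Obase]] := decreasing_nbhs_base fcX y.
have /choice [next nextP] : forall En : set X * nat, exists E',
    clopen En.1 /\ ~ En.1 y ->
    [/\ clopen E', ~ E' y, En.1 `<=` E', E' `\` En.1 `<=` O En.2 &
        E' `\` En.1 !=set0].
  move=> [E n] /=; have [[cE Ey]|nE] := pselect (clopen E /\ ~ E y).
    by have [E' ?] := clopen_increment cE Ey (nO n); exists E'.
  by exists set0 => /nE.
pose fix E n := if n is m.+1 then next (E m, m) else set0.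
have cE n : clopen (E n) /\ ~ E n y.
  elim: n => [|n IHn]; first by split; [exact: clopen0|].
  by have [] := nextP (E n, n) IHn.
have ES n : E n `<=` E n.+1 by have [] := nextP (E n, n) (cE n).
have EO n : E n.+1 `\` E n `<=` O n by have [] := nextP (E n, n) (cE n).
have E0 n : E n.+1 `\` E n !=set0 by have [] := nextP (E n, n) (cE n).
have Emono m n : (m <= n)%N -> E m `<=` E n.
  move=> /subnK <-; elim: (n - m)%N => // k IHk u /IHk; exact: ES.
have cS n : clopen (first_index (fun n => E n.+1) @^-1` [set Some n]).
  by apply: first_index_clopen => m; have [] := cE m.+1.
exists (first_index (fun n => E n.+1)); split=> //.
- move=> n; have [t [Et nEt]] := E0 n; exists t; apply/first_indexS; split=> //.
  by move=> m mn /(Emono _ _ mn).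
- by apply/first_indexN => n; have [] := cE n.+1.
- move=> u uy; case qu : (first_index _ u) => [n|].
    have [oS _] := cS n.
    by apply: filterS (open_nbhs_nbhs (conj oS qu)) => b ->.
  have [N nN [n ON]] : exists2 N, nbhs u N & exists n, O n `&` N = set0.
    have := T2X; rewrite open_hausdorff => /(_ y u).
    case=> [|[U V] /= [/set_mem Uy /set_mem Vu] [oU oV /eqP UV]].
      by apply/eqP => yu; apply: uy.
    exists V; first exact: open_nbhs_nbhs.
    have [n OU] := Obase U (open_nbhs_nbhs (conj oU Uy)).
    by exists n; rewrite -subset0 -UV => v [/OU].
  have nEu : nbhs u (~` E n).
    apply: open_nbhs_nbhs; split; first by rewrite openC; have [[]] := cE n.
    move=> Enu; have /first_indexN /(_ n) := qu; apply; exact: ES.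
  apply: filterS2 nN nEu => b Nb nEb _; apply/first_indexN => m Eb.
  suff: E n b by [].
  have [mn|nm] := leqP m.+1 n; first exact: Emono Eb.
  have {nm} [k mk] : exists k, m.+1 = (k + n)%N by exists (m.+1 - n)%N; rewrite subnK // ltnW.
  move: Eb; rewrite mk; elim: k {mk} => [//|k IHk] Eb.
  apply: IHk; apply: contrapT => nEk.
  have : set0 b by rewrite -ON; split=> //; apply: Odec (leq_addl k n) _ (EO _ _ (conj Eb nEk)).
  by [].
Qed.

(** The pieces of [X \ {x}] other than the one of [z] are absorbed by the
    clopen sets converging to [y], pulled back along [f]: the labelling [r] of
    [X \ {x, z}] merges the label [n] of [p] with the label [n] of [q o f]. *)
Lemma doubly_punctured (x y z : X) (p : X -> option nat) (f g : X -> X) :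
  (forall u, p u = None <-> u = x) ->
  (forall n, clopen (p @^-1` [set Some n])) ->
  z <> x -> f z = y ->
  embeds (p @^-1` [set p z]) [set: X] f g ->
  embeds [set: X] (p @^-1` [set p z]) g f ->
  homeo_sets (~` [set x; z]) (~` [set y]).
Proof.
move=> pN cp zx fz fg gf; have [q [cq q0 qy qlc]] := accumulating_label y.
case pz : (p z) fg gf => [k|]; last by move/pN : pz.
set P := p @^-1` [set Some k] => fg gf.
have Pz : P z := pz.
have Px u : P u -> u <> x by move=> Pu /pN; rewrite Pu.
have fy u : P u -> f u = y -> u = z.
  by move=> Pu fu; have [_ <- _] := fg u Pu; rewrite fu -fz; have [] := fg z Pz.
pose r u := if p u == Some k then q (f u) else p u.
have rP u : P u -> r u = q (f u) by rewrite /r => ->; rewrite eqxx.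
have rNP u : ~ P u -> r u = p u by rewrite /r; case: eqP.
apply: (@homeo_sets_glue _ _ _ _ r q) => //.
- move=> u uxz; have [Pu|nPu] := pselect (P u).
    have fuy : f u <> y by move=> /(fy u Pu) uz; apply: uxz; right.
    have [_ _ /(_ _ (qlc _ fuy)) cfu] := fg u Pu.
    have nP : nbhs u P by apply: open_nbhs_nbhs; split=> //; have [] := cp k.
    apply: filterS2 cfu nP => b qb Pb bxz; rewrite !rP //.
    by apply: qb => // /(fy b Pb) bz; apply: bxz; right.
  case pu : (p u) => [m|]; last by case: uxz; left; apply/pN.
  have nPm : nbhs u (p @^-1` [set Some m]).
    by apply: open_nbhs_nbhs; split=> //; have [] := cp m.
  apply: filterS nPm => b pb _.
  by rewrite !rNP ?pu // /P /= pb -pu.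
- case=> [n|].
    have -> : ~` [set y] `&` q @^-1` [set Some n] = q @^-1` [set Some n].
      by apply/seteqP; split=> [u []//|u qu]; split=> // uy; move: qu; rewrite /= uy qy.
    have -> : ~` [set x; z] `&` r @^-1` [set Some n] =
        (P `&` f @^-1` (q @^-1` [set Some n])) `|`
        (p @^-1` [set Some n] `&` ~` P).
      apply/seteqP; split=> u.
      - move=> [uxz ru]; have [Pu|nPu] := pselect (P u).
        + by left; split=> //; rewrite /= -rP.
        + by right; split=> //; rewrite /= -rNP.
      - move=> [[Pu qu]|[pu nPu]]; last first.
          split; last by rewrite /= rNP.
          by move=> [/pN|uz]; [rewrite pu|apply: nPu; rewrite uz].
        split; last by rewrite /= rP.
        move=> [|uz]; first exact: Px.
        by move: qu; rewrite /= uz fz qy.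
    apply: clopen_homeo_sets (cq n) (q0 n).
      apply: clopenU; first exact: embeds_preimage_clopen fg (cp k) (cq n).
      by apply: clopenI => //; apply: (@clopenC _ _ set0); exact: cp.
    have [v qv] := q0 n; exists (g v); left; have [Pgv fgv _] := gf v I.
    by split=> //; rewrite /= fgv.
  have -> : ~` [set x; z] `&` r @^-1` [set None] =
      P `&` f @^-1` (~` [set y] `&` q @^-1` [set None]).
    apply/seteqP; split=> u.
    - move=> [uxz ru]; have [Pu|nPu] := pselect (P u); last first.
        by exfalso; apply: uxz; left; apply/pN; rewrite -rNP.
      split=> //; split=> /=; last by rewrite -rP.
      by move=> /(fy u Pu) uz; apply: uxz; right.
    - move=> [Pu [fuy qfu]]; split; last by rewrite /= rP.
      move=> [|uz]; first exact: Px.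
      by apply: fuy; rewrite uz.
  rewrite -[X in homeo_sets _ X]setTI.
  exact: homeo_sets_preimage fg gf.
Qed.

End h_homogeneous_space.

(** * Non-reconstructibility *)

Unset Implicit Arguments.

Theorem theorem5p1 (X : topologicalType) (hX : h_homogeneous X)
    (fcX : first_countable X) (cX : compact [set: X]) (T2X : hausdorff_space X)
    (ntX : exists x y : X, x <> y) (dX : dense (one_point_components X)) :
  ~ reconstructible X.
Proof.
have [a [b ab]] := ntX.
have [|x [_ x1]] := dX [set: X] _ openT; first by exists a.
have [p [pN cp]] := shrinking_label fcX cX T2X x1.
have piece z : z <> x -> exists f g,
    embeds (p @^-1` [set p z]) [set: X] f g /\
    embeds [set: X] (p @^-1` [set p z]) g f.
  move=> zx; apply: (clopen_homeo_sets hX).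
  - by case pz : (p z) => [n|]; [exact: cp|move/pN : pz].
  - by exists z.
  - exact: clopenT.
  - by exists z.
move=> /(_ (set_type (~` [set x]))) rX.
apply: (punctured_not_homeomorphic hX cX T2X ntX (x := x)); apply: rX.
have deckE (z : set_type (~` [set x])) y f g :
    f (set_val z) = y ->
    embeds (p @^-1` [set p (set_val z)]) [set: X] f g ->
    embeds [set: X] (p @^-1` [set p (set_val z)]) g f ->
    homeomorphism_class (set_type (~` [set z])) =
    homeomorphism_class (set_type (~` [set y])).
  move=> fz fg gf; apply: homeomorphism_class_eq.
  apply: homeomorphic_trans (homeomorphic_punctured z) _.
  apply: homeo_sets_homeomorphic.
  exact: (doubly_punctured hX fcX cX T2X ntX dX pN cp (set_valP z) fz fg gf).
apply/funext => C; apply/propext; split=> [[z ->]|[y ->]].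
- have [f [g [fg gf]]] := piece _ (set_valP z).
  by exists (f (set_val z)); exact: deckE fg gf.
- have [z0 z0x] : exists z, z <> x.
    have [ax|] := pselect (a = x); last by exists a.
    by exists b => bx; apply: ab; rewrite ax bx.
  have [f [g [fg gf]]] := piece _ z0x.
  have [/= pgy fgy _] := gf y I.
  (* [g y] has the label of [z0], and [x] is the only point labelled [None]. *)
  have gyx : (~` [set x]) (g y) by move=> /pN; rewrite pgy => /pN.
  exists (SigSub (mem_set gyx)); apply/esym.
  by apply: (deckE _ y f g) => //=; rewrite pgy.
Qed.
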